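(* Let $m\ge1$, let $\alpha_1,\dots,\alpha_m\in[0,\pi/2)$, and let $X_j\in\mathbb{M}^s_{n,\alpha_j}$ for $j=1,2,\dots,m$. Then $$\omega(X_1\circ\cdots\circ X_m)\le\prod_{j=1}^m\sec(\alpha_j)\,\omega(X_j).$$
   Context: $\mathbb{M}_n$ is the algebra of all $n\times n$ complex matrices. For $X=[x_{ij}],Y=[y_{ij}]\in\mathbb{M}_n$ the Hadamard product is $X\circ Y=[x_{ij}y_{ij}]$. The numerical range of $X\in\mathbb{M}_n$ is $W(X)=\{\langle Xx,x\rangle : x\in\mathbb{C}^n,\ \|x\|=1\}$, with the standard inner product and Euclidean norm on $\mathbb{C}^n$, and the numerical radius is $\omega(X)=\sup\{|z| : z\in W(X)\}$. For $\alpha\in[0,\pi/2)$ let $S_\alpha=\{z\in\mathbb{C} : \operatorname{Re}(z)>0,\ |\operatorname{Im}(z)|\le\tan(\alpha)\operatorname{Re}(z)\}$, and let $\mathbb{M}^s_{n,\alpha}$ be the class of all $X\in\mathbb{M}_n$ such that $W(zX)\subset S_\alpha$ for some $z\in\mathbb{C}$ with $|z|=1$. *)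

(* Defs.v *)
From mathcomp Require Import all_boot all_order all_algebra.
From mathcomp Require Import all_classical all_reals all_analysis.
From mathcomp Require Import complex.
Set Implicit Arguments.
Unset Strict Implicit.
Unset Printing Implicit Defensive.
Import Order.TTheory GRing.Theory Num.Theory.
Import ComplexField.Normc.
Local Open Scope classical_set_scope.
Local Open Scope ring_scope.
Local Open Scope complex_scope.

Definition hadamard (R : realType) (n : nat) (X Y : 'M[R[i]]_n) : 'M[R[i]]_n :=
  map2_mx *%R X Y.

(* The all-ones matrix is the unit of the Hadamard product, so for a nonempty
   family this is X_1 o ... o X_m. *)
Definition hadamard_prod (R : realType) (n m : nat)
    (X : 'I_m -> 'M[R[i]]_n) : 'M[R[i]]_n :=
  \big[@hadamard R n / const_mx 1]_(j < m) X j.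

Definition inner (R : realType) (n : nat) (x y : 'cV[R[i]]_n) : R[i] :=
  \sum_(k < n) x k 0 * conjc (y k 0).

(* The canonical `|z| on R[i] takes its values in R[i]; normc is the
   R-valued modulus. *)
Definition norm2 (R : realType) (n : nat) (x : 'cV[R[i]]_n) : R :=
  Num.sqrt (\sum_(k < n) normc (x k 0) ^+ 2).

Definition numrange (R : realType) (n : nat) (X : 'M[R[i]]_n) : set R[i] :=
  [set inner (X *m x) x | x in [set x | norm2 x = 1]].

(* sup is real-valued; the set is bounded, and nonempty when n > 0. For n = 0
   it is empty and its sup is 0. *)
Definition numradius (R : realType) (n : nat) (X : 'M[R[i]]_n) : R :=
  sup [set normc w | w in numrange X].

Definition sec (R : realType) (a : R) : R := (cos a)^-1.

Definition sector (R : realType) (a : R) : set R[i] :=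
  [set z | 0 < complex.Re z /\ `|complex.Im z| <= tan a * complex.Re z].

Definition sectorial_class (R : realType) (n : nat) (a : R) : set 'M[R[i]]_n :=
  [set X | exists z : R[i], normc z = 1 /\ numrange (z *: X) `<=` sector a].

(* Main.v *)
(** Rotate [X_j] to [A = H + iK] with [H], [K] Hermitian and numerical range in
    the sector.  Since [|<Kx,x>| <= tan a * <Hx,x>],
    [U = (H / cos a + K / sin a) / 2] and [V = (H / cos a - K / sin a) / 2] are
    positive semidefinite, [A = e^(ia) U + e^(-ia) V] and [U + V = sec a * H].
    Expanding the Hadamard product of the [A]'s gives a combination, with
    unimodular coefficients, of Hadamard products of the [U]'s and [V]'s, which
    are positive semidefinite by Schur's theorem.  So its quadratic form is
    bounded by that of the Hadamard product of the [U + V]'s.  Finally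
    [U + V <= sec a * w(X_j) * I], and [P <= c I], [Q <= d I] imply
    [P o Q <= c d I] for positive semidefinite [P], [Q]. *)

Require Import Defs.
From mathcomp Require Import all_boot all_order all_algebra.
From mathcomp Require Import all_classical all_reals all_analysis.
From mathcomp Require Import complex.
From mathcomp Require Import ring lra.
Import Order.TTheory GRing.Theory Num.Theory.
Local Open Scope classical_set_scope.
Local Open Scope ring_scope.

(** * Quadratic forms and positive semidefinite matrices *)

Section PositiveSemidefinite.
#[local] Set Implicit Arguments.
#[local] Unset Strict Implicit.
Variables (C : numClosedFieldType) (n : nat).
Implicit Types (A B P Q : 'M[C]_n) (x : 'I_n -> C) (c d : C).

Definition hmul A B : 'M[C]_n := map2_mx *%R A B.

(** The form [<A x, x>]. Here [x] is a plain function, so that it can be multiplied entrywise by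
    another vector. *)
Definition qform A x : C := \sum_k \sum_l A k l * x l * (x k)^*.

(** In the order on [C], [0 <= z] also says that [z] is real. *)
Definition psd A := (forall k l, A l k = (A k l)^*) /\ forall x, 0 <= qform A x.

Lemma qformD A B x : qform (A + B) x = qform A x + qform B x.
Proof.
rewrite /qform -big_split; apply: eq_bigr => k _ /=.
by rewrite -big_split; apply: eq_bigr => l _ /=; rewrite mxE !mulrDl.
Qed.

Lemma qformZ c A x : qform (c *: A) x = c * qform A x.
Proof.
rewrite /qform mulr_sumr; apply: eq_bigr => k _.
by rewrite mulr_sumr; apply: eq_bigr => l _; rewrite mxE !mulrA.
Qed.

Lemma qformB A B x : qform (A - B) x = qform A x - qform B x.
Proof. by rewrite qformD -scaleN1r qformZ mulN1r. Qed.

Lemma qform_scalar c x : qform c%:M x = c * \sum_k `|x k| ^+ 2.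
Proof.
rewrite /qform mulr_sumr; apply: eq_bigr => k _.
rewrite (bigD1 k) //= big1 => [|l lk]; first by rewrite mxE eqxx addr0 normCK mulrA.
by rewrite mxE eq_sym (negbTE lk) !mul0r.
Qed.

Lemma qform_adj A x : qform (A ^t Num.conj)%sesqui x = (qform A x)^*.
Proof.
rewrite /qform rmorph_sum /= exchange_big /=; apply: eq_bigr => k _.
rewrite rmorph_sum; apply: eq_bigr => l _.
by rewrite !mxE !rmorphM /= conjCK; ring.
Qed.

Lemma psd_add A B : psd A -> psd B -> psd (A + B).
Proof.
move=> [hA pA] [hB pB]; split=> [k l|x]; first by rewrite !mxE rmorphD hA hB.
by rewrite qformD addr_ge0.
Qed.

Lemma psd_scale c A : 0 <= c -> psd A -> psd (c *: A).
Proof.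
move=> c0 [hA pA]; split=> [k l|x]; last by rewrite qformZ mulr_ge0.
by rewrite !mxE rmorphM /= hA (geC0_conj c0).
Qed.

Lemma psd_scalar c : 0 <= c -> psd c%:M.
Proof.
move=> c0; split=> [k l|x].
  by rewrite !mxE eq_sym; case: eqP => _; rewrite ?mulr1n ?mulr0n ?conjC0 ?(geC0_conj c0).
by rewrite qform_scalar mulr_ge0 // sumr_ge0 // => k _; rewrite exprn_ge0.
Qed.

Lemma psd_scalar_sub c A : 0 <= c -> (forall k l, A l k = (A k l)^*) ->
  (forall x, qform A x <= c * \sum_k `|x k| ^+ 2) -> psd (c%:M - A).
Proof.
move=> c0 hA Ac; split=> [k l|x]; last by rewrite qformB qform_scalar subr_ge0.
have [/(_ k l) hc _] := psd_scalar c0.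
by move: hc; rewrite !mxE rmorphB /= => ->; rewrite hA.
Qed.

Lemma psd_ones : psd (const_mx 1).
Proof.
split=> [k l|x]; first by rewrite !mxE conjC1.
suff -> : qform (const_mx 1) x = `|\sum_k x k| ^+ 2 by rewrite exprn_ge0.
rewrite normCK rmorph_sum mulr_sumr; apply: eq_bigr => k _.
by rewrite mulr_suml; apply: eq_bigr => l _; rewrite mxE mul1r.
Qed.

(** * Spectral decomposition and the Schur product theorem *)

Lemma psd_decomposition Q : psd Q ->
  exists (d : 'I_n -> C) (p : 'I_n -> 'I_n -> C),
    (forall i, 0 <= d i) /\
    (forall k l, Q k l = \sum_i d i * (p i k)^* * p i l).
Proof.
move=> [hQ pQ].
have Qherm : (Q ^t Num.conj)%sesqui = Q.
  by apply/matrixP => k l; rewrite !mxE -hQ.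
have /orthomx_spectralP : Q \is normalmx.
  by apply/normalmxP; rewrite Qherm.
set P := spectralmx Q; set sp := spectral_diag Q => EQ.
have Pu : P \is unitarymx by apply: spectral_unitarymx.
(* As [P] is unitary, [Q = P^* diag(sp) P]: the weights are the eigenvalues and the vectors are the
   rows of [P]. *)
exists (fun i => sp 0 i), (fun i k => P i k); split=> [i|k l].
  have ED : P *m Q *m (P ^t Num.conj)%sesqui = diag_mx sp.
    rewrite {}EQ invmx_unitary // !mulmxA (unitarymxP Pu) mul1mx.
    by rewrite -mulmxA (unitarymxP Pu) mulmx1.
  have /matrixP/(_ i i) := ED; rewrite [RHS]mxE eqxx mulr1n => <-.
  (* The eigenvalue is the form of [Q] at the conjugated row [i] of [P], hence nonnegative. *)
  suff -> : (P *m Q *m (P ^t Num.conj)%sesqui) i i = qform Q (fun l => (P i l)^*).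
    exact: pQ.
  rewrite mxE /qform exchange_big; apply: eq_bigr => l _.
  rewrite mxE mulr_suml; apply: eq_bigr => k _.
  by rewrite !mxE conjCK; ring.
rewrite {1}EQ invmx_unitary // mxE; apply: eq_bigr => i _.
by rewrite mul_mx_diag !mxE [_ * sp _ _]mulrC.
Qed.

(* Schur product theorem: with [Q = \sum_i d i * (p i)^* (p i)^T], the form of
   [Q o P] at [x] is [\sum_i d i] times the form of [P] at [p i * x]. *)
Lemma psd_hmul Q P : psd Q -> psd P -> psd (hmul Q P).
Proof.
move=> pQ [hP pP]; split=> [k l|x]; first by rewrite !mxE rmorphM hP pQ.1.
have [d [p [d0 EQ]]] := psd_decomposition pQ.
suff -> : qform (hmul Q P) x = \sum_i d i * qform P (fun l => p i l * x l).
  by apply: sumr_ge0 => i _; rewrite mulr_ge0.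
under [RHS]eq_bigr do rewrite mulr_sumr.
rewrite exchange_big; apply: eq_bigr => k _ /=.
under [RHS]eq_bigr do rewrite mulr_sumr.
rewrite exchange_big; apply: eq_bigr => l _ /=.
rewrite mxE EQ !mulr_suml; apply: eq_bigr => i _.
by rewrite rmorphM; ring.
Qed.

(** * Bilinearity and bounds for Hadamard products *)

Lemma hmulDr A B Q : hmul Q (A + B) = hmul Q A + hmul Q B.
Proof. by apply/matrixP => k l; rewrite !mxE mulrDr. Qed.

Lemma hmulDl A B Q : hmul (A + B) Q = hmul A Q + hmul B Q.
Proof. by apply/matrixP => k l; rewrite !mxE mulrDl. Qed.

Lemma hmulZr c A Q : hmul Q (c *: A) = c *: hmul Q A.
Proof. by apply/matrixP => k l; rewrite !mxE mulrCA. Qed.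

Lemma hmulZl c A Q : hmul (c *: A) Q = c *: hmul A Q.
Proof. by apply/matrixP => k l; rewrite !mxE mulrA. Qed.

Lemma hmulA A B Q : hmul A (hmul B Q) = hmul (hmul A B) Q.
Proof. by apply/matrixP => k l; rewrite !mxE mulrA. Qed.

Lemma hmul1l A : hmul (const_mx 1) A = A.
Proof. by apply/matrixP => k l; rewrite !mxE mul1r. Qed.

Lemma hmul1r A : hmul A (const_mx 1) = A.
Proof. by apply/matrixP => k l; rewrite !mxE mulr1. Qed.

(** Compare through [c I o Q]: the difference is [(c I - P) o Q + c (I o (d I - Q))], and Schur's
    theorem applies to both terms. *)
Lemma psd_hmul_le c d P Q : 0 <= c -> psd Q -> psd (c%:M - P) -> psd (d%:M - Q) ->
  psd ((c * d)%:M - hmul P Q).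
Proof.
move=> c0 pQ pcP pdQ.
suff -> : (c * d)%:M - hmul P Q
    = hmul (c%:M - P) Q + c *: hmul 1%:M (d%:M - Q).
  apply: psd_add; first exact: psd_hmul.
  by apply: psd_scale => //; apply: psd_hmul => //; apply: psd_scalar.
apply/matrixP => k l; rewrite !mxE.
by case: eqP => _; rewrite ?mulr1n ?mulr0n; ring.
Qed.

Lemma psd_hprod m (P : 'I_m -> 'M[C]_n) : (forall j, psd (P j)) ->
  psd (\big[hmul/const_mx 1]_j P j).
Proof. by move=> pP; apply: big_ind => //; [exact: psd_ones | exact: psd_hmul]. Qed.

(** The family starts at one factor: the empty product is the all-ones matrix, which is not below
    the identity once [n > 1]. *)
Lemma psd_hprod_le m (P : 'I_m.+1 -> 'M[C]_n) (c : 'I_m.+1 -> C) :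
  (forall j, 0 <= c j) -> (forall j, psd (P j)) ->
  (forall j, psd ((c j)%:M - P j)) ->
  psd ((\prod_j c j)%:M - \big[hmul/const_mx 1]_j P j).
Proof.
elim: m P c => [|m IH] P c c0 pP pcP.
  by rewrite big_ord1 big_ord_recl big_ord0 hmul1r.
rewrite big_ord_recl [X in _ - X]big_ord_recl.
apply: psd_hmul_le => //; first exact: psd_hprod.
by apply: IH.
Qed.

(** Induction with [Q] as an accumulator: peeling off a factor replaces [Q] by [Q o U] and [Q o V],
    again positive semidefinite. The triangle inequality drops the unimodular coefficients. *)
Lemma norm_qform_hprod_le m (u v : 'I_m -> C) (U V : 'I_m -> 'M[C]_n) Q x :
  (forall j, `|u j| = 1) -> (forall j, `|v j| = 1) ->
  (forall j, psd (U j)) -> (forall j, psd (V j)) -> psd Q ->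
  `|qform (hmul Q (\big[hmul/const_mx 1]_j (u j *: U j + v j *: V j))) x|
    <= qform (hmul Q (\big[hmul/const_mx 1]_j (U j + V j))) x.
Proof.
move=> u1 v1 pU pV; elim: m u v U V u1 v1 pU pV Q => [|m IH] u v U V u1 v1 pU pV Q pQ.
  by rewrite !big_ord0 hmul1r ger0_norm // pQ.2.
rewrite !big_ord_recl !hmulA !hmulDr !hmulDl !hmulZr !hmulZl !qformD !qformZ.
apply: le_trans (ler_normD _ _) _.
rewrite !normrM u1 v1 !mul1r.
by apply: lerD; apply: IH => //; apply: psd_hmul.
Qed.

Lemma norm_qform_hprod m (u v c : 'I_m.+1 -> C) (U V : 'I_m.+1 -> 'M[C]_n) x :
  (forall j, `|u j| = 1) -> (forall j, `|v j| = 1) -> (forall j, 0 <= c j) ->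
  (forall j, psd (U j)) -> (forall j, psd (V j)) ->
  (forall j, psd ((c j)%:M - (U j + V j))) ->
  `|qform (\big[hmul/const_mx 1]_j (u j *: U j + v j *: V j)) x|
    <= (\prod_j c j) * \sum_k `|x k| ^+ 2.
Proof.
move=> u1 v1 c0 pU pV pc.
(* The all-ones matrix serves as the initial accumulator. *)
rewrite -[X in qform X]hmul1l.
apply: le_trans (norm_qform_hprod_le x u1 v1 pU pV psd_ones) _.
rewrite hmul1l -qform_scalar -subr_ge0.
have [_ /(_ x)] := psd_hprod_le c0 (fun j => psd_add (pU j) (pV j)) pc.
by rewrite qformB.
Qed.

End PositiveSemidefinite.

(** * Numerical radius and numerical range through quadratic forms *)

Section Sectorial.
Variables (R : realType) (n : nat).
#[local] Set Implicit Arguments.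
#[local] Unset Strict Implicit.
Local Open Scope complex_scope.
Import ComplexField.Normc.
Local Notation C := R[i].
Implicit Types (A X : 'M[C]_n) (x : 'cV[C]_n) (a : R).

Lemma normc_norm (z : C) : `|z| = (normc z)%:C.
Proof. by rewrite normc_def; case: z. Qed.

Lemma inner_qform X x : inner (X *m x) x = qform X (fun k => x k 0).
Proof.
apply: eq_bigr => k _; rewrite mxE mulr_suml.
by apply: eq_bigr.
Qed.

Lemma norm2_sqr x : ((norm2 x) ^+ 2)%:C = \sum_k `|x k 0| ^+ 2.
Proof.
rewrite sqr_sqrtr; last by apply: sumr_ge0 => k _; rewrite sqr_ge0.
by rewrite rmorph_sum; apply: eq_bigr => k _ /=; rewrite rmorphXn /= normc_norm.
Qed.

Lemma normc_qform_le_numradius X x : norm2 x = 1 ->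
  normc (qform X (fun k => x k 0)) <= numradius X.
Proof.
move=> x1; apply: ub_le_sup; last first.
  by exists (inner (X *m x) x); [exists x | rewrite inner_qform].
(* The numerical range is bounded by the sum of the moduli of the entries, since a unit vector has
   coordinates of modulus at most 1. *)
exists (\sum_k \sum_l normc (X k l)) => _ [_ [y y1 <-] <-].
rewrite inner_qform -lecR -normc_norm rmorph_sum /=.
have yk k : `|y k 0| <= 1.
  rewrite -(@expr_le1 _ 2) //.
  have <- : ((norm2 y) ^+ 2)%:C = 1 by rewrite y1 expr1n.
  rewrite norm2_sqr (bigD1 k) //= lerDl.
  by apply: sumr_ge0 => j _; rewrite exprn_ge0.
apply: le_trans (ler_norm_sum _ _ _) _; apply: ler_sum => k _.
rewrite rmorph_sum /=.
apply: le_trans (ler_norm_sum _ _ _) _; apply: ler_sum => l _.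
rewrite !normrM norm_conjC -normc_norm -[leRHS]mulr1 -mulrA.
by rewrite ler_wpM2l // mulr_ile1.
Qed.

Lemma numradius_ge0 X : 0 <= numradius X.
Proof.
rewrite /numradius; set E := (X in sup X).
have [E0|/eqP/set0P [_ [_ [x x1 _] _]]] := pselect (E = set0); first by rewrite E0 sup0.
apply: le_trans (normc_qform_le_numradius X x1).
by case: (qform _ _) => p q; rewrite sqrtr_ge0.
Qed.

(** Normalizing a nonzero [y] scales the form by [r], its squared norm. This carries facts about
    unit vectors over to all vectors. *)
Lemma qform_unit X (y : 'I_n -> C) :
  (forall k, y k = 0) \/
  exists (r : R) x, [/\ 0 < r, norm2 x = 1,
    qform X y = r%:C * qform X (fun k => x k 0) &
    \sum_k `|y k| ^+ 2 = r%:C].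
Proof.
pose x0 : 'cV[C]_n := \col_k y k.
have Ex0 : \sum_k `|y k| ^+ 2 = ((norm2 x0) ^+ 2)%:C.
  by rewrite norm2_sqr; apply: eq_bigr => k _; rewrite mxE.
have [N0|N0] := eqVneq (norm2 x0) 0.
  left=> k; move: Ex0; rewrite N0 expr0n /=.
  move/eqP; rewrite psumr_eq0 => [/allP/(_ k)|j _]; last by rewrite exprn_ge0.
  by rewrite mem_index_enum expf_eq0 normr_eq0 => /(_ isT)/eqP.
have Npos : 0 < norm2 x0 by rewrite lt_neqAle eq_sym N0 sqrtr_ge0.
set N := norm2 x0 in N0 Npos Ex0.
have NC : N%:C != 0 by rewrite fmorph_eq0.
right; exists (N ^+ 2), ((N%:C)^-1 *: x0); split=> //.
- by rewrite exprn_gt0.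
- apply/eqP; rewrite -(@eqrXn2 _ 2) ?sqrtr_ge0 // expr1n; apply/eqP/complexI.
  transitivity (N%:C^-1 ^+ 2 * \sum_k `|y k| ^+ 2).
    rewrite norm2_sqr mulr_sumr; apply: eq_bigr => k _.
    by rewrite !mxE normrM exprMn normfV (@ger0_norm _ N%:C) ?ler0c ?ltW.
  by rewrite Ex0 rmorphXn /= -exprMn mulVf // expr1n.
- rewrite /qform mulr_sumr; apply: eq_bigr => k _.
  rewrite mulr_sumr; apply: eq_bigr => l _.
  have -> : Num.conj ((N%:C^-1 *: x0) k 0) = N%:C^-1 * Num.conj (y k).
    by rewrite !mxE rmorphM fmorphV /= (@geC0_conj _ N%:C) ?ler0c ?ltW.
  by rewrite !mxE rmorphXn /=; field.
Qed.

Lemma norm_qform_le X (y : 'I_n -> C) :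
  `|qform X y| <= (numradius X)%:C * \sum_k `|y k| ^+ 2.
Proof.
have [y0|[r [x [r0 x1 -> ->]]]] := qform_unit X y.
  rewrite /qform !big1 ?normr0 ?mulr0 // => k _.
    by rewrite y0 normr0 expr0n.
  by rewrite big1 // => l _; rewrite y0 mulr0 mul0r.
rewrite normrM [leRHS]mulrC (@ger0_norm _ r%:C) ?ler0c ?(ltW r0) //
  ler_wpM2l ?ler0c ?(ltW r0) //.
by rewrite normc_norm lecR normc_qform_le_numradius.
Qed.

Lemma numrange_sector_qform a A (y : 'I_n -> C) : numrange A `<=` sector a ->
  0 <= complex.Re (qform A y) /\
  `|complex.Im (qform A y)| <= tan a * complex.Re (qform A y).
Proof.
move=> As; have [y0|[r [x [r0 x1 -> _]]]] := qform_unit A y.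
  suff -> : qform A y = 0 by rewrite normr0 mulr0.
  by rewrite /qform !big1 // => k _; rewrite big1 // => l _; rewrite y0 mulr0 mul0r.
have [] : sector a (qform A (fun k => x k 0)).
  by apply: As; exists x => //; rewrite inner_qform.
case: (qform _ _) => p q /= p0 pq.
rewrite !mul0r subr0 addr0 normrM gtr0_norm // mulrCA.
by rewrite mulr_ge0 ?ler_wpM2l // ltW.
Qed.

(** * Hermitian parts and the splitting of a sectorial matrix *)

Definition herm_re A : 'M[C]_n := (2^-1)%:C *: (A + A ^t Num.conj)%sesqui.
(** The coefficient is [1 / (2i)]. *)
Definition herm_im A : 'M[C]_n := (- 'i * (2^-1)%:C) *: (A - A ^t Num.conj)%sesqui.

Lemma herm_reE A k l : herm_re A l k = Num.conj (herm_re A k l).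
Proof.
rewrite !mxE; case: (A k l) (A l k) => p q [s t].
by congr Complex; rewrite /=; ring.
Qed.

Lemma herm_imE A k l : herm_im A l k = Num.conj (herm_im A k l).
Proof.
rewrite !mxE; case: (A k l) (A l k) => p q [s t].
by congr Complex; rewrite /=; ring.
Qed.

Lemma herm_re_im A : A = herm_re A + 'i *: herm_im A.
Proof.
apply/matrixP => k l; rewrite !mxE; case: (A k l) (A l k) => p q [s t].
by congr Complex; rewrite /=; field.
Qed.

Lemma qform_herm_re A y : qform (herm_re A) y = (complex.Re (qform A y))%:C.
Proof.
rewrite /herm_re qformZ qformD qform_adj; case: (qform _ _) => p q.
by congr Complex; rewrite /=; field.
Qed.

Lemma qform_herm_im A y : qform (herm_im A) y = (complex.Im (qform A y))%:C.
Proof.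
rewrite /herm_im qformZ qformB qform_adj; case: (qform _ _) => p q.
by congr Complex; rewrite /=; field.
Qed.

Lemma psd_herm_comb A (s t : R) :
  (forall y, 0 <= s * complex.Re (qform A y) + t * complex.Im (qform A y)) ->
  psd (s%:C *: herm_re A + t%:C *: herm_im A).
Proof.
move=> st; split=> [k l|y].
  have E i j : (s%:C *: herm_re A + t%:C *: herm_im A) i j =
      s%:C * herm_re A i j + t%:C * herm_im A i j by rewrite !mxE.
  rewrite !E (herm_reE A k l) (herm_imE A k l).
  by case: (herm_re A k l) (herm_im A k l) => p q [p' q']; congr Complex; rewrite /=; ring.
by rewrite qformD (qformZ s%:C) (qformZ t%:C) qform_herm_re qform_herm_im -!rmorphM -rmorphD ler0c.
Qed.

Lemma sectorial_decomposition a X : 0 <= a < pi / 2 -> sectorial_class a X ->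
  exists (u v : C) (U V : 'M[C]_n),
    [/\ `|u| = 1, `|v| = 1, psd U & psd V] /\
    X = u *: U + v *: V /\
    psd ((sec a * numradius X)%:C%:M - (U + V)).
Proof.
move=> /andP[a0 api] [z [z1 Ws]].
set A := z *: X in Ws.
have Nz : `|z| = 1 by rewrite normc_norm z1.
have z0 : z != 0 by rewrite -normr_eq0 Nz oner_eq0.
have XE : X = z^-1 *: A by rewrite scalerA mulVf // scale1r.
have Re0 y := (numrange_sector_qform y Ws).1.
have Ri y := (numrange_sector_qform y Ws).2.
have cpos : 0 < cos a.
  apply: cos_gt0_pihalf; rewrite api andbT; apply: lt_le_trans a0.
  by rewrite oppr_lt0 divr_gt0 // pi_gt0.
have sec0 : 0 <= sec a by rewrite invr_ge0 ltW.
(* The form of [herm_re A] is at most the modulus of that of [A], which the rotation by [z] leaves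
   equal to that of [X]. *)
have radius y : (complex.Re (qform A y))%:C <= (numradius X)%:C * \sum_k `|y k| ^+ 2.
  apply: le_trans (norm_qform_le X y).
  have -> : `|qform X y| = `|qform A y| by rewrite qformZ normrM Nz mul1r.
  rewrite normc_def lecR; case: (qform A y) => p q /=.
  by apply: le_trans (ler_norm p) _; rewrite -sqrtr_sqr ler_wsqrtr // lerDl sqr_ge0.
(* Common to both choices of [U = s1 H + t1 K] and [V = s2 H + t2 K]: the two complex equations give
   [A = u U + v V], and the last two conditions make the form of [U + V] equal to [sec a] times that
   of [H]. *)
have comb (u v : C) (s1 t1 s2 t2 : R) : `|u| = 1 -> `|v| = 1 ->
    u * s1%:C + v * s2%:C = 1 -> u * t1%:C + v * t2%:C = 'i ->
    (forall y, 0 <= s1 * complex.Re (qform A y) + t1 * complex.Im (qform A y)) ->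
    (forall y, 0 <= s2 * complex.Re (qform A y) + t2 * complex.Im (qform A y)) ->
    s1 + s2 = sec a ->
    (forall y, (t1 + t2) * complex.Im (qform A y) = 0) ->
    exists (u v : C) (U V : 'M[C]_n),
    [/\ `|u| = 1, `|v| = 1, psd U & psd V] /\
    X = u *: U + v *: V /\
    psd ((sec a * numradius X)%:C%:M - (U + V)).
  move=> u1 v1 us ut U0 V0 s12 t12.
  have pU := psd_herm_comb U0; have pV := psd_herm_comb V0.
  (* The factor [z^-1] undoes the rotation and keeps the moduli 1. *)
  exists (z^-1 * u), (z^-1 * v).
  exists (s1%:C *: herm_re A + t1%:C *: herm_im A),
    (s2%:C *: herm_re A + t2%:C *: herm_im A).
  split; [by split=> //; rewrite normrM normfV Nz invr1 mul1r|split].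
    rewrite XE [in LHS](herm_re_im A) -!scalerA -scalerDr; congr (_ *: _).
    by rewrite !scalerDr !scalerA addrACA -!scalerDl us ut scale1r.
  apply: psd_scalar_sub; first by rewrite ler0c mulr_ge0 // numradius_ge0.
    exact: (psd_add pU pV).1.
  move=> y.
  rewrite !qformD (qformZ s1%:C) (qformZ t1%:C) (qformZ s2%:C) (qformZ t2%:C).
  rewrite qform_herm_re qform_herm_im addrACA -!mulrDl -!rmorphD -!rmorphM /= s12 t12 addr0.
  by rewrite !rmorphM /= -mulrA ler_wpM2l ?ler0c //.
(* At [a = 0] the coefficient [1 / sin a] is unavailable, but there the form of
   [herm_im A] vanishes, so [U = herm_re A] and [V = herm_im A] will do. *)
have [a00|an0] := eqVneq a 0.
  have Im0 y : complex.Im (qform A y) = 0.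
    by apply/eqP; rewrite -normr_le0 (le_trans (Ri y)) // a00 tan0 mul0r.
  apply: (comb 1 'i 1 0 0 1).
  - exact: normr1.
  - by rewrite normc_def /= expr0n add0r expr1n sqrtr1.
  - by congr Complex; rewrite /=; ring.
  - by congr Complex; rewrite /=; ring.
  - by move=> y; rewrite mul1r Im0 mulr0 addr0; apply: Re0.
  - by move=> y; rewrite Im0 mul0r mulr0 addr0.
  - by rewrite /sec a00 cos0 invr1 addr0.
  - by move=> y; rewrite Im0 mulr0.
have spos : 0 < sin a.
  by apply: sin_gt0_pihalf; rewrite api andbT lt_neqAle eq_sym an0.
have norm_cis (q : R) : q ^+ 2 = sin a ^+ 2 -> `|Complex (cos a) q| = 1.
  by move=> E; rewrite normc_def /= E cos2Dsin2 sqrtr1.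
(* The sector condition cleared of its denominator; it gives the sign of both numerators
   [sin a * p + q * cos a] and [sin a * p - q * cos a] below. *)
have Tri y : `|complex.Im (qform A y)| * cos a <= sin a * complex.Re (qform A y).
  by rewrite -ler_pdivlMr // mulrAC.
(* Here [u = e^(ia)] and [v = e^(-ia)], so [u + v = 2 cos a] and [u - v = 2i sin a]. *)
apply: (comb (Complex (cos a) (sin a)) (Complex (cos a) (- sin a))
  ((2 * cos a)^-1) ((2 * sin a)^-1) ((2 * cos a)^-1) (- (2 * sin a)^-1)).
- exact: norm_cis.
- by apply: norm_cis; rewrite sqrrN.
- congr Complex; rewrite /=; field; exact: lt0r_neq0.
- congr Complex; rewrite /=; field; exact: lt0r_neq0.
- move=> y; set p := complex.Re _; set q := complex.Im _.
  have -> : (2 * cos a)^-1 * p + (2 * sin a)^-1 * q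
      = (sin a * p + q * cos a) / (2 * cos a * sin a).
    by field; rewrite !lt0r_neq0.
  rewrite divr_ge0 ?mulr_ge0 ?(ltW spos) ?(ltW cpos) //.
  have := Tri y; rewrite -/p -/q; have := ler_norm (- q); rewrite normrN; nra.
- move=> y; set p := complex.Re _; set q := complex.Im _.
  have -> : (2 * cos a)^-1 * p + - (2 * sin a)^-1 * q
      = (sin a * p - q * cos a) / (2 * cos a * sin a).
    by field; rewrite !lt0r_neq0.
  rewrite divr_ge0 ?mulr_ge0 ?(ltW spos) ?(ltW cpos) //.
  have := Tri y; rewrite -/p -/q; have := ler_norm q; nra.
- rewrite /sec; field; exact: lt0r_neq0.
- by move=> y; rewrite subrr mul0r.
Qed.

End Sectorial.

(** * The bound for the Hadamard product *)

Local Open Scope complex_scope.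

Theorem theorem2p4 (R : realType) (n m : nat) (hm : (1 <= m)%N)
    (alpha : 'I_m -> R) (X : 'I_m -> 'M[R[i]]_n)
    (halpha : forall j : 'I_m, 0 <= alpha j < pi / 2)
    (hX : forall j : 'I_m, sectorial_class (alpha j) (X j)) :
  numradius (hadamard_prod X) <= \prod_(j < m) (sec (alpha j) * numradius (X j)).
Proof.
have c0 j : 0 <= sec (alpha j) * numradius (X j).
  have /andP[a0 api] := halpha j.
  rewrite mulr_ge0 ?numradius_ge0 // invr_ge0 ltW // cos_gt0_pihalf // api andbT.
  by apply: lt_le_trans a0; rewrite oppr_lt0 divr_gt0 // pi_gt0.
rewrite /numradius; set E := (E in sup E).
(* An empty range, as for [n = 0], has [sup] equal to 0. *)
have [E0|/eqP/set0P E0] := pselect (E = set0).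
  by rewrite E0 sup0; apply: prodr_ge0 => j _; apply: c0.
apply: ge_sup => // _ [_ [x x1 <-] <-].
have /choice [u /choice [v /choice [U /choice [V dec]]]] :=
  fun j => sectorial_decomposition (halpha j) (hX j).
(* Since [m] is positive it is a successor, the form that [norm_qform_hprod] takes. *)
case: m hm alpha X halpha hX c0 E E0 u v U V dec
  => // m _ alpha X _ _ c0 _ _ u v U V dec.
rewrite inner_qform -lecR rmorph_prod /= -normc_norm.
have -> : hadamard_prod X =
    \big[@hmul R[i] n/const_mx 1]_j (u j *: U j + v j *: V j).
  by apply: eq_bigr => j _; have [_ []] := dec j.
have xsum : \sum_k `|x k 0| ^+ 2 = 1 by rewrite -norm2_sqr x1 expr1n.
rewrite -[leRHS]mulr1 -[X in _ <= _ * X]xsum.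
apply: norm_qform_hprod => j; have [[]] := dec j => // *.
- by rewrite ler0c.
- by have [_ []] := dec j.
Qed.
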